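(* Let $f:\langle C,U\rangle\to\langle A,R\rangle$ and $g:\langle C,U\rangle\to\langle B,S\rangle$ be morphisms in $\mathsf{EndoRel}$. Let $\langle A+B,R+S\rangle$ be the disjoint union of $\langle A,R\rangle$ and $\langle B,S\rangle$, let $E$ be the least equivalence relation on $A+B$ containing all the pairs $\langle\langle f(c),0\rangle,\langle g(c),1\rangle\rangle$ with $c\in C$, and let $[\cdot]:A+B\to(A+B)/E$ be the quotient map. Then $\langle (A+B)/E,(R+S)/E\rangle$, together with the maps $a\mapsto[\langle a,0\rangle]$ from $A$ and $b\mapsto[\langle b,1\rangle]$ from $B$, is a pushout of $f$ and $g$ in $\mathsf{EndoRel}$.
   Context: $\mathsf{EndoRel}$ is the category whose objects are pairs $\langle A,R\rangle$ with $A$ a set and $R\subseteq A\times A$ an arbitrary binary relation on $A$, and whose morphisms $f:\langle A,R\rangle\to\langle B,S\rangle$ are the functions $f:A\to B$ such that $\langle a,a'\rangle\in R$ implies $\langle f(a),f(a')\rangle\in S$ for all $a,a'\in A$. The disjoint union: $A+B=(A\times\{0\})\cup(B\times\{1\})$, and $R+S$ is the relation on $A+B$ in which $\langle x,y\rangle$ is related to $\langle x',y'\rangle$ iff ($x\,R\,x'$ and $y=y'=0$) or ($x\,S\,x'$ and $y=y'=1$). For a binary relation $V$ and an equivalence relation $E$ on a set $D$, the quotient relation on $D/E$ is $V/E=\{\langle[a],[b]\rangle : \langle a,b\rangle\in V\}$. *)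

(* Defs.v *)
From Stdlib Require Export Relations.

Set Implicit Arguments.
Unset Strict Implicit.
Unset Printing Implicit Defensive.

Record Category := {
  Obj :> Type;
  Hom : Obj -> Obj -> Type;
  idm : forall X, Hom X X;
  comp : forall X Y Z, Hom Y Z -> Hom X Y -> Hom X Z;
  comp_idl : forall X Y (f : Hom X Y), comp (idm Y) f = f;
  comp_idr : forall X Y (f : Hom X Y), comp f (idm X) = f;
  comp_assoc : forall W X Y Z (h : Hom Y Z) (g : Hom X Y) (f : Hom W X),
    comp h (comp g f) = comp (comp h g) f
}.

Arguments Hom K X Y : rename, clear implicits.
Arguments idm {_} X.
Arguments comp {_ X Y Z} g f.

(* The square  i o f = j o g  is commutative and universal among such. *)
Definition is_pushout (K : Category) (Z X Y P : K)
    (f : Hom K Z X) (g : Hom K Z Y) (i : Hom K X P) (j : Hom K Y P) : Prop :=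
  comp i f = comp j g /\
  forall (Q : K) (h : Hom K X Q) (k : Hom K Y Q), comp h f = comp k g ->
    exists! m : Hom K P Q, comp m i = h /\ comp m j = k.

Record endo := Endo { carrier : Type; rel : relation carrier }.

Arguments Endo carrier rel : clear implicits.

Record endo_hom (X Y : endo) := EndoHom {
  fn :> carrier X -> carrier Y;
  fn_rel : forall a a', rel a a' -> rel (fn a) (fn a')
}.

Definition endo_id (X : endo) : endo_hom X X :=
  @EndoHom X X (fun a => a) (fun _ _ r => r).

Definition endo_comp (X Y Z : endo) (g : endo_hom Y Z) (f : endo_hom X Y) :
    endo_hom X Z :=
  @EndoHom X Z (fun a => g (f a)) (fun _ _ r => fn_rel g (fn_rel f r)).

Definition EndoRel : Category.
Proof.
refine {| Obj := endo; Hom := endo_hom; idm := endo_id; comp := endo_comp |};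
  intros; repeat match goal with u : endo_hom _ _ |- _ => destruct u end;
  reflexivity.
Defined.

Inductive sum_rel (A B : Type) (R : relation A) (S : relation B) :
    relation (A + B) :=
| sum_rel_l x x' : R x x' -> sum_rel R S (inl x) (inl x')
| sum_rel_r x x' : S x x' -> sum_rel R S (inr x) (inr x').

Inductive glue (A B C : Type) (f : C -> A) (g : C -> B) : relation (A + B) :=
| glue_intro c : glue f g (inl (f c)) (inr (g c)).

Definition is_least_equivalence (D : Type) (P E : relation D) : Prop :=
  equivalence D E /\ inclusion D P E /\
  forall E' : relation D, equivalence D E' -> inclusion D P E' ->
    inclusion D E E'.

Lemma clos_rst_is_least_equivalence (D : Type) (P : relation D) :
  is_least_equivalence P (clos_refl_sym_trans D P).
Proof.
split; [apply clos_rst_is_equiv | split].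
- intros x y p; now apply rst_step.
- intros E' [r t s] PE' x y e.
  induction e as [x y p | x | x y _ IH | x y z _ IH1 _ IH2].
  + now apply PE'.
  + apply r.
  + now apply s.
  + now apply (t _ y).
Qed.

(* The set of classes [d] = {x | E d x}.  This is meaningful only when E is an
   equivalence relation, but no proof of that is needed to form the type. *)
Definition quotient (D : Type) (E : relation D) : Type :=
  { X : D -> Prop | exists d, X = E d }.

Definition class (D : Type) (E : relation D) (d : D) : quotient E :=
  exist _ (E d) (ex_intro _ d eq_refl).

Definition quotient_rel (D : Type) (E V : relation D) : relation (quotient E) :=
  fun X Y => exists a b, V a b /\ X = class E a /\ Y = class E b.

Arguments quotient_rel {D} E V _ _.

(* Main.v *)
(** Being least, [E] is contained in the kernel of every map out of [A + B]
    that identifies [inl (f c)] with [inr (g c)]; hence the copairing of a cocone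
    factors through the quotient.  The factorization is a morphism because every
    related pair of classes has related representatives, and it is unique because
    the classes of [inl a] and [inr b] exhaust the quotient. *)

Require Import Defs.
From Stdlib Require Import FunctionalExtensionality PropExtensionality.
From Stdlib Require Import ProofIrrelevance IndefiniteDescription.

(** Proof irrelevance identifies the [fn_rel] fields, so only the underlying functions matter. *)
Lemma endo_hom_ext (X Y : endo) (u v : endo_hom X Y) :
  (forall x, u x = v x) -> u = v.
Proof.
destruct u as [u ur], v as [v vr]; simpl; intros uv.
assert (e : u = v) by now apply functional_extensionality.
subst v; f_equal; apply proof_irrelevance.
Qed.

Lemma class_surj (D : Type) (E : relation D) (X : quotient E) :
  exists d, X = class E d.
Proof. destruct X as [X [d ->]]; now exists d. Qed.

(** Symmetry and transitivity make the predicates [E x] and [E y] hold of the same elements;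
    extensionality turns this into equality. *)
Lemma class_eq (D : Type) (E : relation D) (x y : D) :
  equivalence D E -> E x y -> class E x = class E y.
Proof.
intros [_ t s] xy.
assert (e : E x = E y).
{ apply functional_extensionality; intros z.
  apply propositional_extensionality; split; intros h.
  - now apply (t _ x); [apply s|].
  - now apply (t _ y). }
apply eq_sig_hprop; [intros; apply proof_irrelevance | exact e].
Qed.

(** By reflexivity [y] belongs to its own class, which is also the class of [x]. *)
Lemma class_inj (D : Type) (E : relation D) (x y : D) :
  equivalence D E -> class E x = class E y -> E x y.
Proof.
intros [r _ _] e; apply (f_equal (@proj1_sig _ _)) in e; simpl in e.
rewrite e; apply r.
Qed.

Lemma quotient_lift (D T : Type) (E : relation D) (F : D -> T) :
  equivalence D E -> (forall x y, E x y -> F x = F y) ->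
  exists G : quotient E -> T, forall d, G (class E d) = F d.
Proof.
intros eqE FE.
(* The representative chosen for [class E d] may differ from [d], but it is [E]-related to [d], so
   [F] takes the same value on both. *)
set (rep X := constructive_indefinite_description _ (class_surj D E X)).
exists (fun X => F (proj1_sig (rep X))); intros d.
destruct (rep (class E d)) as [d' dd']; simpl.
symmetry; apply FE; now apply class_inj.
Qed.

Lemma kernel_equivalence (D T : Type) (F : D -> T) :
  equivalence D (fun x y => F x = F y).
Proof. split; red; congruence. Qed.

Lemma least_equivalence_kernel (D T : Type) (P E : relation D) (F : D -> T) :
  is_least_equivalence P E -> (forall x y, P x y -> F x = F y) ->
  forall x y, E x y -> F x = F y.
Proof.
intros [_ [_ least]] PF; exact (least _ (kernel_equivalence _ _ F) PF).
Qed.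

Theorem mainTheorem6 (A B C : Type)
    (R : relation A) (S : relation B) (U : relation C)
    (f : Hom EndoRel (Endo C U) (Endo A R))
    (g : Hom EndoRel (Endo C U) (Endo B S))
    (E : relation (A + B))
    (hE : is_least_equivalence (@glue A B C f g) E) :
  exists (i : Hom EndoRel (Endo A R)
                (Endo (quotient E) (quotient_rel E (sum_rel R S))))
         (j : Hom EndoRel (Endo B S)
                (Endo (quotient E) (quotient_rel E (sum_rel R S)))),
    (forall a : A, i a = class E (inl a)) /\
    (forall b : B, j b = class E (inr b)) /\
    is_pushout f g i j.
Proof.
pose proof hE as [eqE [glueE _]].
unshelve eexists (@EndoHom (Endo A R) (Endo _ _) (fun a => class E (inl a)) _).
{ intros a a' r; exists (inl a), (inl a'); split; [now constructor | now split]. }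
unshelve eexists (@EndoHom (Endo B S) (Endo _ _) (fun b => class E (inr b)) _).
{ intros b b' r; exists (inr b), (inr b'); split; [now constructor | now split]. }
split; [reflexivity | split; [reflexivity | split]].
(* The square commutes because [inl (f c)] and [inr (g c)] form a generating pair of [E]. *)
- apply endo_hom_ext; intros c; apply class_eq; [exact eqE | apply glueE].
  constructor.
- intros Q h k hk.
  set (F := fun x : A + B => match x with inl a => fn h a | inr b => fn k b end).
  destruct (quotient_lift _ _ E F eqE) as [G GE].
  (* On a generating pair [F] takes the values [h (f c)] and [k (g c)], which agree by [hk]
     evaluated at [c]. *)
  { apply (least_equivalence_kernel _ _ _ _ F hE); intros x y [c].
    exact (f_equal (fun m : endo_hom (Endo C U) Q => m c) hk). }
  unshelve eexists (@EndoHom (Endo (quotient E) _) Q G _).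
  (* Related representatives lie in the same summand, where [G] on classes is given by [h] or by
     [k]. *)
  { intros X Y (x & y & [a a' r | b b' r] & -> & ->); rewrite !GE.
    - exact (fn_rel h r).
    - exact (fn_rel k r). }
  split; [split; apply endo_hom_ext; intros x; apply GE |].
  intros m [mh mk]; apply endo_hom_ext; intros X; simpl.
  destruct (class_surj _ _ X) as [[a | b] ->]; rewrite GE; unfold F; symmetry.
  + exact (f_equal (fun m : endo_hom (Endo A R) Q => m a) mh).
  + exact (f_equal (fun m : endo_hom (Endo B S) Q => m b) mk).
Qed.
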